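(* In the $K$-node distributed computing setting described in the context, where the dataset can only be split into at most $S_{\max}$ identically sized packets, the Group-based Coded MapReduce (GCMR) algorithm with groups of $L$ nodes can achieve the communication (shuffling) delay $$T^{\mathrm{GCMR}}_{\mathrm{com}}=\frac{1-\gamma}{\bar t_L}\,T_c,$$ where $$\bar t_L=\gamma\cdot\max\Big\{\tilde K\le K:\ \frac{\tilde K\gamma}{L}\binom{\tilde K/L}{\tilde K\gamma/L}\le S_{\max}\Big\},$$ with $\tilde K$ ranging over numbers of nodes for which $\tilde K/L$ and $\tilde K\gamma/L$ are positive integers.
   Context: MapReduce setting. $K$ nodes process a dataset $\Phi$ of $F$ elements, split into $S\le S_{\max}$ disjoint packets $W_1,\dots,W_S$ of identical size. There are $Q=K$ outputs $\phi_q(\Phi)=r_q(m_q(W_1),\dots,m_q(W_S))$, with map functions $m_q$ and reduce functions $r_q$, one reduce function per node. The values $W_s^q=m_q(W_s)$ are called intermediate values. In the map phase each node computes all $W^q_s$, $q=1,\dots,K$, for the packets assigned to it. In the shuffling phase the nodes communicate so that each node obtains the intermediate values needed by its own reduce function that it did not compute. In the reduce phase each node evaluates its reduce function. The parameter $\gamma$ is the fraction of the dataset that each node maps. $T_c$ is the time required to transmit the entire mapped dataset from one node to another without interference from the other nodes; the delay of the shuffling phase with uncoded transmission is $(1-\gamma)T_c$. Channel. The nodes are fully connected over a shared wireless channel. When a set of $L$ active transmitting nodes jointly sends $\mathbf x\in\mathbb C^{L}$ with power constraint $\mathbb E\|\mathbf x\|^2<P$, receiving node $k$ gets $y_k=\mathbf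 h_k^T\mathbf x+w_k$, where $\mathbf h_k\in\mathbb C^L$ is the fading channel from the transmitters to node $k$ and $w_k$ is unit-power Gaussian noise. The system operates at high SNR (high $P$), with perfect channel state information at the active transmitters and receivers. GCMR algorithm. Let $K'=K/L$ and $\gamma\in\{1/K',2/K',\dots,1\}$. The nodes are split into groups $\mathcal G_i=\{i,i+K',\dots,i+(L-1)K'\}$, $i=1,\dots,K'$, and $\mathcal G_i(j)$ denotes the $j$-th node of $\mathcal G_i$. The dataset is split into $S=K'\gamma\binom{K'}{K'\gamma}$ packets $W_{\tau,\sigma}$, indexed by $\tau\subseteq\{1,\dots,K'\}$ with $|\tau|=K'\gamma$ and by $\sigma\in\tau$; every node of $\mathcal G_i$ is assigned (and maps) all $W_{\tau,\sigma}$ with $i\in\tau$. In the shuffling phase, for every $\mathcal Q\subseteq\{1,\dots,K'\}$ with $|\mathcal Q|=K'\gamma+1$ and every $i\in\mathcal Q$, the nodes of $\mathcal G_i$ act as one distributed transmitter and jointly send $$\sum_{k'\in\mathcal Q\setminus\{i\}}\mathbf H_{i,k'}^{-1}\big[W^{\mathcal G_{k'}(1)}_{\mathcal Q\setminus\{k'\},i},\dots,W^{\mathcal G_{k'}(L)}_{\mathcal Q\setminus\{k'\},i}\big]^T,$$ where $\mathbf H^{-1}_{i,k'}$ is the zero-forcing precoding matrix for the $L\times L$ channel $\mathbf H_{i,k'}$ from group $\mathcal G_i$ to group $\mathcal G_{k'}$, and $\mathcal G_i(j)$ sends the $j$-th entry. Receivers cancel the terms intended for other groups using their own mapped intermediate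 values, and zero-forcing removes the interference within the group. If $S$ exceeds $S_{\max}$, the coding is done over only $\bar K_L=\bar t_L/\gamma$ nodes at a time, so that the subpacketization constraint is respected.
   Formalization: With K̄ = t̄_L/γ, the stated delay is proved when K̄ divides K; otherwise it is multiplied by ⌈K/K̄⌉·K̄/K, since coding over K̄ nodes at a time needs a whole number of batches (e.g. L=1, K=6, γ=1/2, S_max=12: the algorithm needs 24 slots, the formula gives 18). *)

(* Defs.v *)
From HB Require Import structures.
From mathcomp Require Import all_boot all_order all_algebra.
From mathcomp Require Import complex.
From mathcomp Require Import all_classical all_reals all_analysis.

Set Implicit Arguments.
Unset Strict Implicit.
Unset Printing Implicit Defensive.

Import Order.TTheory GRing.Theory Num.Theory.
Import numFieldNormedType.Exports.

Local Open Scope ring_scope.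

Section Awgn.
Context {R : realType}.

Definition sqnorm (x : R[i]) : R := complex.Re x ^+ 2 + complex.Im x ^+ 2.

(* [z (i, true)] and [z (i, false)] are the real and imaginary parts of the
   i-th noise sample.  Unit power: variance 1/2 for each part.  The product
   rule is stated for the whole family; subfamilies are obtained by taking
   [B j = setT] for the remaining indices. *)
Definition awgn d (T : measurableType d) (Pr : probability T R) (I : finType)
    (z : I * bool -> {RV Pr >-> R}) : Prop :=
  (forall j (B : set R), measurable B ->
     distribution Pr (z j) B = normal_prob 0 (Num.sqrt 2^-1) B) /\
  (forall B : I * bool -> set R, (forall j, measurable (B j)) ->
     Pr (\bigcap_j (z j @^-1` B j))%classic =
     (\prod_j Pr (z j @^-1` B j)%classic)%E).

Definition csample d (T : measurableType d) (Pr : probability T R) (I : finType)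
    (z : I * bool -> {RV Pr >-> R}) (w : T) (i : I) : R[i] :=
  (z (i, true) w +i* z (i, false) w)%C.

(* [good] holds except on an event of probability at most [eps]; when the
   failure set is measurable this says that its probability is at most
   [eps], but no measurability of decoders has to be assumed. *)
Definition up_to d (T : measurableType d) (Pr : probability T R) (eps : R)
    (good : T -> Prop) : Prop :=
  exists2 E : set T, measurable E /\ (Pr E <= eps%:E)%E
                   & forall w, ~ E w -> good w.

End Awgn.

Section Link.
Context {R : realType}.

Record link_code (l B : nat) := LinkCode {
  modulate : B.-tuple bool -> 'I_l -> R[i];
  demodulate : ('I_l -> R[i]) -> B.-tuple bool }.

(* Transmission of one message over the interference-free link y = g x + w in
   [l] channel uses: every codeword has average power below [P], and every
   message is decoded with error probability at most [eps]. *)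
Definition link_reliable (g : R[i]) (P eps : R) l B (c : link_code l B) : Prop :=
  (forall m, (\sum_u sqnorm (modulate c m u)) / l%:R < P) /\
  (forall d (T : measurableType d) (Pr : probability T R)
     (z : 'I_l * bool -> {RV Pr >-> R}), awgn z ->
   forall m, up_to Pr eps (fun w =>
     demodulate c (fun u => g * modulate c m u + csample z w u) = m)).

(* At SNR [P] the messages have beta log2 P + o(log P) bits. *)
Definition message_size (beta : R) (B : R -> nat) : Prop :=
  ((B P)%:R / (ln P / ln 2) @[P --> +oo] --> beta)%classic.

(* At high SNR, messages of beta log2 P + o(log P) bits take [l] channel uses
   from one node to another without interference. *)
Definition link_high_snr (g : R[i]) (beta : R) (l : nat) : Prop :=
  exists (B : R -> nat) (c : forall P, link_code l (B P)) (eps : R -> R),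
    [/\ message_size beta B,
        (eps P @[P --> +oo] --> (0 : R))%classic
      & \forall P \near +oo%R, link_reliable g P (eps P) (c P)].

End Link.

Arguments link_code : clear implicits.

Section Protocol.
Context {R : realType}.
Variables (Node Packet Slot : finType) (V : Type) (l : nat).

(* An element of [Node -> Packet -> V] is a table of intermediate values:
   entry (q, p) is m_q(W_p), and node q evaluates the q-th reduce function.
   The shuffling phase is a sequence of slots of [l] channel uses each. *)
Record protocol := Protocol {
  assigned : Node -> {set Packet};
  active : Slot -> {set Node};
  encode : Node -> (Node -> Packet -> V) -> Slot -> 'I_l -> R[i];
  decode : Node -> (Node -> Packet -> V) -> (Slot -> 'I_l -> R[i]) ->
           Packet -> V }.

Definition delay (_ : protocol) : nat := (#|Slot| * l)%N.

(* What a node sends and decodes depends only on the intermediate values that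
   it has computed in the map phase. *)
Definition local (p : protocol) : Prop :=
  forall k W W', (forall q j, j \in assigned p k -> W q j = W' q j) ->
  (forall s u, encode p k W s u = encode p k W' s u) /\
  (forall y j, decode p k W y j = decode p k W' y j).

Definition power_ok (P : R) (p : protocol) : Prop :=
  forall W s,
    (\sum_u \sum_(k in active p s) sqnorm (encode p k W s u)) / l%:R < P.

(* [h k j] is the channel coefficient from node [j] to node [k]; nodes do not
   receive while they transmit. *)
Definition received (h : Node -> Node -> R[i]) (p : protocol) W
    (z : Node * Slot * 'I_l -> R[i]) k s u : R[i] :=
  if k \in active p s then 0
  else \sum_(j in active p s) h k j * encode p j W s u + z (k, s, u).

Definition obtained (h : Node -> Node -> R[i]) (p : protocol) W z k
    : {ffun Packet -> V} :=
  [ffun j => if j \in assigned p k then W k j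
             else decode p k W (received h p W z k) j].

(* For every dataset, map functions [m] and reduce functions [r], all nodes
   output phi_q = r_q(m_q(W_1), ..., m_q(W_S)) up to probability [eps].  The
   packets have identical size: their contents have a common type [A]. *)
Definition reliable (h : Node -> Node -> R[i]) (eps : R) (p : protocol) : Prop :=
  forall d (T : measurableType d) (Pr : probability T R)
    (z : Node * Slot * 'I_l * bool -> {RV Pr >-> R}), awgn z ->
  forall (A Out : Type) (W : Packet -> A) (m : Node -> A -> V)
    (r : Node -> {ffun Packet -> V} -> Out),
  up_to Pr eps (fun w => forall q,
    r q (obtained h p (fun q' j => m q' (W j)) (csample z w) q) =
    r q [ffun j => m q (W j)]).

Definition shuffles (L : nat) (h : Node -> Node -> R[i]) (P eps : R)
    (p : protocol) : Prop :=
  [/\ local p, forall s, #|active p s| = L, power_ok P p & reliable h eps p].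

End Protocol.

Arguments protocol : clear implicits.

(* GCMR for [Kg] groups of [L] nodes, coding over [n] groups at a time, with
   packets indexed by sets of [t] out of [n] group types.  Indices start at 0:
   the node (i, j) is the j-th node of the i-th group, i.e. the node of number
   i + j Kg.  The group [i] has type [i mod n] and belongs to the batch
   [i / n]. *)
Section GCMR.
Context {R : realType}.
Variables (n t Kg L : nat) (n_gt0 : (0 < n)%N) (n_le : (n <= Kg)%N).

Definition gnode : finType := ('I_Kg * 'I_L)%type.

(* W_(tau, sigma) *)
Definition packet : finType :=
  {p : {set 'I_n} * 'I_n | (#|p.1| == t) && (p.2 \in p.1)}.

(* ceil (Kg / n) *)
Definition batches : nat := (Kg.-1 %/ n).+1.

(* ((b, Q), i): in batch b, transmission of group i for the set Q *)
Definition slot : finType :=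
  {s : 'I_batches * {set 'I_n} * 'I_n |
     (#|s.1.2| == t.+1) && (s.2 \in s.1.2)}.

Definition gtype (g : 'I_Kg) : 'I_n := Ordinal (ltn_pmod g n_gt0).

Definition gbatch (g : 'I_Kg) : 'I_batches := inord (g %/ n).

(* The group of type [i] in batch [b].  If n does not divide Kg, the last batch
   is completed with groups of the first one; otherwise the default value of
   [insubd] is never used. *)
Definition member (b : 'I_batches) (i : 'I_n) : 'I_Kg :=
  insubd (widen_ord n_le i) (b * n + i)%N.

Definition gcmr_assigned (k : gnode) : {set packet} :=
  [set p : packet | gtype k.1 \in (val p).1].

Variable h : gnode -> gnode -> R[i].

(* H_(i, i'): from group i to group i' *)
Definition group_channel (i i' : 'I_Kg) : 'M[R[i]]_L :=
  \matrix_(r, c) h (i', r) (i, c).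

Variables (l B : nat) (c : link_code R l B).

Notation table := (gnode -> packet -> B.-tuple bool).

(* [insub] is [None] only for pairs that are not packets.  The normalization
   required by the power constraint is part of [modulate c]. *)
Definition symbol (W : table) (q : gnode) (p : {set 'I_n} * 'I_n) (u : 'I_l)
    : R[i] :=
  if insub p is Some p' then modulate c (W q p') u else 0.

Definition precoded (W : table) b (Q : {set 'I_n}) (i k' : 'I_n) u
    : 'cV[R[i]]_L :=
  invmx (group_channel (member b i) (member b k')) *m
  \col_j symbol W (member b k', j) (Q :\ k', i) u.

Definition sender (s : slot) : 'I_Kg := member (val s).1.1 (val s).2.

Definition gcmr_active (s : slot) : {set gnode} :=
  [set k : gnode | k.1 == sender s].

Definition gcmr_signal (W : table) (s : slot) u : 'cV[R[i]]_L :=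
  let: (b, Q, i) := val s in \sum_(k' in Q :\ i) precoded W b Q i k' u.

Definition gcmr_encode (k : gnode) (W : table) (s : slot) u : R[i] :=
  if k \in gcmr_active s then gcmr_signal W s u k.2 0 else 0.

(* A node of type a recovers W_(tau, sigma), a not in tau, from the
   transmission of group sigma for Q = a |: tau, after having cancelled the
   terms intended for the groups other than its own. *)
Definition gcmr_decode (k : gnode) (W : table) (y : slot -> 'I_l -> R[i])
    (p : packet) : B.-tuple bool :=
  let: (tau, i) := val p in
  let a := gtype k.1 in let b := gbatch k.1 in let Q := a |: tau in
  demodulate c (fun u =>
    (if insub (b, Q, i) is Some s then y s u else 0) -
    \sum_(k' in Q :\ i :\ a)
      (row k.2 (group_channel (member b i) k.1) *m precoded W b Q i k' u) 0 0).

Definition gcmr : protocol R gnode packet slot (B.-tuple bool) l :=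
  Protocol gcmr_assigned gcmr_active gcmr_encode gcmr_decode.

End GCMR.

(* At high SNR, GCMR shuffles intermediate values of beta log2 P + o(log P)
   bits, in slots of [l] channel uses. *)
Definition gcmr_high_snr {R : realType} (n t Kg L : nat) (n_gt0 : (0 < n)%N)
    (n_le : (n <= Kg)%N) (h : gnode Kg L -> gnode Kg L -> R[i])
    (beta : R) (l : nat) : Prop :=
  exists (B : R -> nat) (c : forall P, link_code R l (B P)) (eps : R -> R),
    [/\ message_size beta B,
        (eps P @[P --> +oo] --> (0 : R))%classic
      & \forall P \near +oo%R,
          shuffles L h P (eps P) (gcmr t n_gt0 n_le h (c P))].

Section Subpacketization.
Context {R : realType}.
Variables (gamma : R) (L Smax : nat).

Definition redundancy (Kt : nat) : nat := Num.truncn (Kt%:R * gamma / L%:R).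

Definition admissible (Kt : nat) : bool :=
  [&& (0 < Kt)%N, (L %| Kt)%N,
      Kt%:R * gamma / L%:R \is a Num.nat, 0 < Kt%:R * gamma / L%:R
    & (redundancy Kt * 'C(Kt %/ L, redundancy Kt) <= Smax)%N].

Definition Kbar (K : nat) : nat :=
  \max_(Kt < K.+1 | admissible Kt) Kt.

Definition tbar (K : nat) : R := gamma * (Kbar K)%:R.

Lemma Kbar_group_le K : (Kbar K %/ L <= K %/ L)%N.
Proof.
by apply/leq_div2r/bigmax_leqP => i _; rewrite -ltnS.
Qed.

Lemma Kbar_group_gt0 K (L_gt0 : (0 < L)%N)
  (hS : exists2 Kt, (Kt <= K)%N & admissible Kt) : (0 < Kbar K %/ L)%N.
Proof.
have [Kt leK aKt] := hS; rewrite divn_gt0//.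
have /and3P[Kt0 dvL _] := aKt.
apply: (leq_trans (dvdn_leq Kt0 dvL)).
by rewrite /Kbar (bigD1 (Ordinal (leK : (Kt < K.+1)%N)))//= leq_maxl.
Qed.

End Subpacketization.

(* Duration, in channel uses, of the transmission of the K S intermediate
   values of the mapped dataset over an interference-free link that takes [l]
   channel uses per intermediate value.  In particular the K (1 - gamma) S
   values requested in the shuffling phase take (1 - gamma) T_c uncoded. *)
Definition Tc (K S l : nat) : nat := (K * S * l)%N.

(* Main.v *)
Require Import Defs.
From HB Require Import structures.
From mathcomp Require Import all_boot all_order all_algebra.
From mathcomp Require Import complex.
From mathcomp Require Import all_classical all_reals all_analysis.
From mathcomp Require Import ring lra.

Set Implicit Arguments.
Unset Strict Implicit.
Unset Printing Implicit Defensive.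

Import Order.TTheory GRing.Theory Num.Theory.
Import numFieldNormedType.Exports.

Local Open Scope ring_scope.

(* Node q, of type a, misses the packets (tau, i) with a \notin tau.  In the slot
   of Q = a |: tau sent by group i, zero-forcing turns the term intended for the
   group of q into the codeword of the missing value, and each other term k' of
   the signal only involves packets indexed by Q :\ k', a set containing a, so
   that q can subtract it.  What remains is a unit-gain link with the noise of
   that slot: decoding errors add up over the pairs (node, packet).  The precoders
   multiply the power by a constant depending on the channel only; running the
   link code at power P / C compensates for it, and since ln (P / C) ~ ln P this
   does not change the message size to first order.  The delay is a count:
   (t + 1) C(n, t + 1) = (n - t) C(n, t) and 1 - gamma = (n - t) / n. *)

(** * Counting packets, slots and assigned packets *)

(** Sum of the sizes of the selected sets. The predicate [P] lets one count serve for all packets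
    ([xpredT]) and for those mapped by one node ([a \in A]). *)
Lemma card_flags n (P : pred {set 'I_n}) t :
  #|{: {p : {set 'I_n} * 'I_n | (P p.1 && (#|p.1| == t)) && (p.2 \in p.1)}}| =
  (t * #|[set A : {set 'I_n} | P A && (#|A| == t)]|)%N.
Proof.
rewrite card_sig.
transitivity (\sum_(A : {set 'I_n} | P A && (#|A| == t)) \sum_(i in A) 1)%N.
  by rewrite pair_big_dep -sum1_card; apply: eq_bigl.
under eq_bigr => A /andP[_ /eqP cA] do rewrite sum1_card cA.
by rewrite sum_nat_cond_const mulnC cardsE.
Qed.

(** Pascal's rule: the (t+1)-subsets avoiding [a] are those of its complement, and C(n, t+1) -
    C(n-1, t+1) = C(n-1, t). *)
Lemma card_draws_mem n t (a : 'I_n) :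
  #|[set A : {set 'I_n} | (a \in A) && (#|A| == t.+1)]| = 'C(n.-1, t).
Proof.
have H := cardsID [set A : {set 'I_n} | a \in A] [set A : {set 'I_n} | #|A| == t.+1].
rewrite card_draws card_ord in H.
have E1 : [set A : {set 'I_n} | #|A| == t.+1] :&: [set A : {set 'I_n} | a \in A] =
   [set A : {set 'I_n} | (a \in A) && (#|A| == t.+1)].
  by apply/setP => A; rewrite !inE andbC.
have E2 : [set A : {set 'I_n} | #|A| == t.+1] :\: [set A : {set 'I_n} | a \in A] =
   [set A : {set 'I_n} | A \subset [set~ a] & #|A| == t.+1].
  by apply/setP => A; rewrite !inE finset.subsetC finset.sub1set inE.
rewrite E1 E2 cards_draws cardsC1 card_ord in H.
case: n a H {E1 E2} => [[]//|n] a /=; rewrite binS addnC.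
exact: addnI.
Qed.

Lemma card_packet n t : #|packet n t| = (t * 'C(n, t))%N.
Proof. by rewrite (card_flags xpredT) card_draws card_ord. Qed.

(** A slot is a batch together with a (t+1)-set and one of its elements, that is, with a packet for
    the parameter [t.+1]. *)
Lemma card_slot n t Kg :
  #|slot n t Kg| = (batches n Kg * (t.+1 * 'C(n, t.+1)))%N.
Proof.
transitivity (batches n Kg * #|packet n t.+1|)%N; last by rewrite card_packet.
rewrite !card_sig.
rewrite -[X in (X * _)%N]card_ord -cardX -!sum1_card.
rewrite (reindex (fun p : 'I_(batches n Kg) * ({set 'I_n} * 'I_n) =>
  (p.1, p.2.1, p.2.2))) /=; last first.
  by exists (fun p => (p.1.1, (p.1.2, p.2))) => [[? []]|[[]]].
by apply: eq_bigl => -[b [A i]]; rewrite !inE.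
Qed.

Lemma card_gcmr_assigned n t Kg L (n_gt0 : (0 < n)%N) (k : gnode Kg L) :
  (0 < t)%N -> #|gcmr_assigned t n_gt0 k| = (t * 'C(n.-1, t.-1))%N.
Proof.
case: t => // t _ /=; set a := gtype n_gt0 k.1.
rewrite -(card_draws_mem t a) -(card_flags (fun A => a \in A)) card_sig.
rewrite /gcmr_assigned cardsE -(fintype.card_image val_inj).
apply: eq_card => -[A i]; rewrite !inE; apply/fintype.imageP/idP => /=.
  case=> p ap Ep; have /= := valP p; rewrite -Ep => /andP[-> ->].
  by have /= := ap : a \in (val p).1; rewrite -Ep => ->.
move=> /andP[/andP[aA cA] iA].
have H : (#|A| == t.+1) && (i \in A) by rewrite cA.
by exists (exist _ (A, i) H).
Qed.

(** * Admissible numbers of nodes *)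

Lemma Kbar_admissible {R : realType} (gamma : R) L Smax K :
  (exists2 Kt, (Kt <= K)%N & admissible gamma L Smax Kt) ->
  admissible gamma L Smax (Kbar gamma L Smax K).
Proof.
move=> [Kt leK aKt]; rewrite /Kbar.
have [|Km aKm ->//] := @eq_bigmax_cond _
  [pred Kt : 'I_K.+1 | admissible gamma L Smax Kt] (fun i => i : nat).
by apply/card_gt0P; exists (Ordinal (leK : (Kt < K.+1)%N)); rewrite inE.
Qed.

(** Admissibility includes integrality of the quotient, so the truncation in [redundancy] is
    exact. *)
Lemma admissible_redundancy {R : realType} (gamma : R) L Smax Kt :
  (0 < L)%N -> admissible gamma L Smax Kt ->
  (0 < redundancy gamma L Kt)%N /\
  (redundancy gamma L Kt)%:R = gamma * (Kt %/ L)%:R.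
Proof.
move=> L_gt0 /and5P[_ LKt tN t_gt0 _].
have tE : (redundancy gamma L Kt)%:R = Kt%:R * gamma / L%:R by exact: truncnK.
split; first by rewrite -(ltr0n R) tE.
rewrite tE natr_div ?unitfE ?pnatr_eq0 -?lt0n//.
by rewrite mulrA (mulrC gamma).
Qed.

(** * Squared modulus *)

Lemma sqnorm_ge0 {R : realType} (x : R[i]) : 0 <= sqnorm x.
Proof. by rewrite addr_ge0 ?sqr_ge0. Qed.

Lemma sqnorm0 {R : realType} : sqnorm (0 : R[i]) = 0.
Proof. by rewrite /sqnorm /= expr0n addr0. Qed.

Lemma sqnormM {R : realType} (x y : R[i]) : sqnorm (x * y) = sqnorm x * sqnorm y.
Proof. by case: x => a b; case: y => c d; rewrite /sqnorm /=; ring. Qed.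

(** Iterates |x + y|^2 <= 2 (|x|^2 + |y|^2). The crude factor is harmless: it ends up in a constant
    independent of the power. *)
Lemma sqnorm_sum {R : realType} (I : Type) (s : seq I) (P : pred I)
    (F : I -> R[i]) :
  sqnorm (\sum_(i <- s | P i) F i) <=
  2 ^+ size s * \sum_(i <- s | P i) sqnorm (F i).
Proof.
elim: s => [|i s IHs]; first by rewrite !big_nil sqnorm0 mulr0.
rewrite !big_cons /= exprS.
have S_ge0 : 0 <= \sum_(j <- s | P j) sqnorm (F j).
  by apply: sumr_ge0 => j _; exact: sqnorm_ge0.
have e_ge1 : 1 <= 2 ^+ size s :> R by rewrite exprn_ege1// ler1n.
have sqnormD (x y : R[i]) : sqnorm (x + y) <= 2 * (sqnorm x + sqnorm y).
  case: x => a b; case: y => c d; rewrite /sqnorm /= -subr_ge0.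
  (* Parallelogram law: the gap is |x - y|^2. *)
  rewrite [X in 0 <= X](_ : _ = (a - c) ^+ 2 + (b - d) ^+ 2); last by ring.
  by rewrite addr_ge0 ?sqr_ge0.
have Fi_ge0 := sqnorm_ge0 (F i).
have eS_ge0 : 0 <= 2 ^+ size s * \sum_(j <- s | P j) sqnorm (F j).
  by rewrite mulr_ge0// exprn_ge0.
have eF_ge : sqnorm (F i) <= 2 ^+ size s * sqnorm (F i) by rewrite ler_peMl.
case: ifP => _; rewrite -mulrA; last by apply: le_trans IHs _; lra.
by apply: le_trans (sqnormD _ _) _; rewrite ler_pM2l// mulrDr lerD.
Qed.

(** * Noise subfamilies and the union bound *)

(** Serves to extract the noise that one node sees in one slot, so that the guarantee of the link
    code applies to it. *)
Lemma awgn_comp {R : realType} d (T : measurableType d) (Pr : probability T R)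
    (I J : finType) (f : J -> I) (z : I * bool -> {RV Pr >-> R}) :
  injective f -> awgn z -> awgn (fun j => z (f j.1, j.2)).
Proof.
move=> f_inj [zN zI]; split=> [j B|B mB]; first exact: zN.
(* [pre] partially inverts the map induced by [f]. Outside the image [B'] is the full set, whose
   probability 1 drops out of the product. *)
pose pre (i : I * bool) := [pick j : J * bool | (f j.1, j.2) == i].
pose B' i : set R := if pre i is Some j then B j else setT.
have preK j : pre (f j.1, j.2) = Some j.
  rewrite /pre; case: pickP => [j' /eqP[/f_inj]|/(_ j)]; last by rewrite eqxx.
  by case: j j' => [? ?] [? ?] /= -> ->.
have mB' i : measurable (B' i) by rewrite /B'; case: (pre i).
have /= := zI B' mB'.
rewrite (bigID (fun i => isSome (pre i))) /= [X in (_ * X)%E]big1 => [|i]; last first.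
  rewrite /B'; case: (pre i) => // _.
  by rewrite preimage_setT probability_setT.
rewrite mule1 (reindex_omap (fun j : J * bool => (f j.1, j.2)) pre) => [|i]; last first.
  by rewrite /pre; case: pickP => //= j /eqP ->.
under eq_bigl do rewrite preK /= eqxx.
under eq_bigr do rewrite /B' preK.
move=> <-; congr (Pr _); apply/seteqP; split=> w wB i _ /=.
  rewrite /B' /pre; case: pickP => // j /eqP <-.
  exact: wB.
by have := wB (f i.1, i.2) Logic.I; rewrite /= /B' preK.
Qed.

(** Union bound: the failure event of the family is the union of the individual ones. *)
Lemma up_to_forall {R : realType} d (T : measurableType d) (Pr : probability T R)
    (eps : R) (J : finType) (good : J -> T -> Prop) :
  (forall j, up_to Pr eps (good j)) ->
  up_to Pr (#|J|%:R * eps) (fun w => forall j, good j w).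
Proof.
move=> goodP.
suff [E ? Egood] : up_to Pr ((size (enum J))%:R * eps)
    (fun w => forall j, j \in enum J -> good j w).
  by exists E => [|w /Egood good_w j]; [rewrite cardE|apply: good_w; rewrite mem_enum].
elim: (enum J) => [|j s [E [mE PE] Egood]].
  by exists set0 => //; rewrite measure0 mul0r; split.
have [E' [mE' PE'] E'good] := goodP j.
exists (E' `|` E)%classic => [|w /not_orP[wE' wE] k].
  split; first exact: measurableU.
  apply: le_trans (measureU2 _ _ _) _ => //.
  by rewrite /= -addn1 natrD addrC mulrDl mul1r EFinD leeD.
rewrite in_cons => /predU1P[->|]; first exact: E'good.
exact: Egood.
Qed.

(** * Asymptotics in the power *)

Lemma ln_cvgy {R : realType} : (@ln R x @[x --> +oo] --> +oo)%classic.
Proof.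
apply/cvgryPge => A; near=> x.
have x_ge : expR A <= x by near: x; exact: nbhs_pinfty_ge.
by rewrite -[A]expRK ler_ln ?posrE ?expR_gt0// (lt_le_trans _ x_ge) ?expR_gt0.
Unshelve. all: by end_near. Qed.

Lemma cvg_divy {R : realType} (C : R) :
  0 < C -> (x / C @[x --> +oo] --> +oo)%classic.
Proof. by move=> C_gt0; apply: gt0_cvgMly; [rewrite invr_gt0|exact: cvg_id]. Qed.

Lemma message_size_scale {R : realType} (beta C : R) (B : R -> nat) :
  0 < C -> message_size beta B -> message_size beta (fun P => B (P / C)).
Proof.
move=> C_gt0 BP; rewrite /message_size.
have ln2 : ln 2 != 0 :> R by rewrite gt_eqF// ln_gt0// ltr1n.
have divCy := cvg_divy C_gt0.
have lnV0 : ((ln x)^-1 @[x --> +oo] --> (0 : R))%classic.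
  apply/gtr0_cvgV0; last exact: ln_cvgy.
  by near=> x; apply: ln_gt0; near: x; exact: nbhs_pinfty_gt.
(* The expression is ln (P / C) / ln P for large P, the factor that turns the denominator ln (P / C)
   into ln P. *)
have ratio1 : (1 - ln C * (ln x)^-1 @[x --> +oo] --> (1 : R))%classic.
  suff : (1 - ln C * (ln x)^-1 @[x --> +oo] --> 1 - ln C * (0 : R))%classic.
    by rewrite mulr0 subr0.
  by apply: cvgB; [exact: cvg_cst|apply: cvgM => //; exact: cvg_cst].
suff : ((B (P / C))%:R / (ln (P / C) / ln 2) * (1 - ln C * (ln P)^-1)
    @[P --> +oo] --> beta * 1)%classic; last first.
  exact: cvgM (cvg_comp _ _ divCy BP) ratio1.
rewrite mulr1; apply: cvg_trans; apply: near_eq_cvg; near=> P.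
have P_gt1 : 1 < P by near: P; exact: nbhs_pinfty_gt.
have PC_gt1 : 1 < P / C.
  by rewrite ltr_pdivlMr// mul1r; near: P; exact: nbhs_pinfty_gt (num_real C).
have lnP_gt0 : 0 < ln P by exact: ln_gt0.
have : 0 < ln (P / C) by exact: ln_gt0.
rewrite /= ln_div ?posrE ?(lt_trans ltr01 P_gt1)// => lnPC_gt0.
by field; rewrite ln2 !gt_eqF.
Unshelve. all: by end_near. Qed.

(** * Locality and decoding *)

Section GCMRCorrectness.
Context {R : realType}.
Variables (n t Kg L : nat) (n_gt0 : (0 < n)%N) (n_le : (n <= Kg)%N).
Variable h : gnode Kg L -> gnode Kg L -> R[i].
Variables (l B : nat) (c : link_code R l B).

(** Both possible values of [insubd], b n + i and the default i, have residue i modulo n. *)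
Lemma gtype_member b i : gtype n_gt0 (member n_le b i) = i.
Proof.
apply: val_inj; rewrite /= /member val_insubd /=.
by case: ifP => _; rewrite ?modnMDl modn_small.
Qed.

(** Euclidean division of [g] by [n]; since g < Kg, the batch index is in range and the default is
    not reached. *)
Lemma member_gtype g : member n_le (gbatch n g) (gtype n_gt0 g) = g.
Proof.
apply: val_inj; rewrite /= /member val_insubd /= inordK.
  by rewrite -divn_eq ltn_ord.
by rewrite ltnS leq_div2r// -ltnS prednK// (leq_ltn_trans _ (ltn_ord g)).
Qed.

Lemma symbol_packet (W : gnode Kg L -> packet n t -> B.-tuple bool) q
    (p : packet n t) u :
  symbol c W q (val p) u = modulate c (W q p) u.
Proof. by rewrite /symbol valK. Qed.

Lemma eq_symbol (W W' : gnode Kg L -> packet n t -> B.-tuple bool) q tp u :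
  (forall p, val p = tp -> W q p = W' q p) -> symbol c W q tp u = symbol c W' q tp u.
Proof. by move=> WW'; rewrite /symbol; case: insubP => // p _ /WW' ->. Qed.

Lemma eq_precoded (W W' : gnode Kg L -> packet n t -> B.-tuple bool)
    b (Q : {set 'I_n}) i k' u :
  (forall q p, val p = (Q :\ k', i) -> W q p = W' q p) ->
  precoded n_le h c W b Q i k' u = precoded n_le h c W' b Q i k' u.
Proof.
move=> WW'; congr (_ *m _); apply/colP => j; rewrite !mxE.
by apply: eq_symbol => p; exact: WW'.
Qed.

Lemma gcmr_local : local (gcmr t n_gt0 n_le h c).
Proof.
move=> k W W' WW'; split=> [[[[b Q] i] /= sP] u|y [[tau i] pP]] /=.
  rewrite /gcmr_encode; have [|//] := boolP (k \in _).
  rewrite inE /sender /= => /eqP kE.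
  rewrite /gcmr_signal /=; apply: (congr1 (fun A : 'cV_L => A k.2 0)).
  (* As k' differs from i, the set [Q :\ k'] still contains i, the type of the sender, which has
     therefore mapped these packets. *)
  apply: eq_bigr => k' /setD1P[k'i _].
  apply: eq_precoded => q p pE; apply: WW'.
  rewrite inE pE /= kE gtype_member !inE eq_sym k'i.
  by case/andP: sP.
rewrite /gcmr_decode /=; apply: (congr1 (demodulate c)); apply/funext => u.
apply: (congr1 (fun x => _ - x)); apply: eq_bigr => k' /setD1P[k'a _].
rewrite (@eq_precoded _ W') // => q p pE; apply: WW'.
by rewrite inE pE /= !inE eq_sym k'a eqxx.
Qed.

Lemma card_gcmr_active (s : slot n t Kg) : #|gcmr_active L n_le s| = L.
Proof.
have -> : gcmr_active L n_le s = finset.setX [set sender n_le s] [set: 'I_L].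
  by apply/setP => -[i j]; rewrite !inE andbT.
by rewrite cardsX cards1 cardsT card_ord mul1n.
Qed.

Lemma received_gcmr (W : gnode Kg L -> packet n t -> B.-tuple bool) z q s u :
  q.1 != sender n_le s ->
  received h (gcmr t n_gt0 n_le h c) W z q s u =
  (row q.2 (group_channel h (sender n_le s) q.1) *m
     gcmr_signal n_le h c W s u) 0 0 + z (q, s, u).
Proof.
move=> qs; rewrite /received /= inE (negPf qs); congr (_ + _).
(* The active nodes are the pairs (sender, j), so the superposition on the channel is a
   row-by-column product over j. *)
rewrite mxE (reindex_onto (pair (sender n_le s)) snd) /=.
  apply: eq_big => j; first by rewrite inE !eqxx.
  by move=> _; rewrite !mxE /gcmr_encode inE eqxx; case: q {qs}.
by move=> [i j]; rewrite inE /= => /eqP ->.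
Qed.

Hypothesis h_inv : forall i i' : 'I_Kg, i != i' -> group_channel h i i' \in unitmx.

Lemma received_precoded (W : gnode Kg L -> packet n t -> B.-tuple bool)
    (q : gnode Kg L) (p : packet n t) u :
  gtype n_gt0 q.1 \notin (val p).1 ->
  let a := gtype n_gt0 q.1 in let b := gbatch n q.1 in let i := (val p).2 in
  (row q.2 (group_channel h (member n_le b i) q.1) *m
     precoded n_le h c W b (a |: (val p).1) i a u) 0 0 = modulate c (W q p) u.
Proof.
case: p => [[tau i] pP] /= aNtau; have /andP[_ /= itau] := pP.
rewrite /precoded member_gtype -row_mul mulmxA mulmxV ?h_inv//.
  rewrite mul1mx !mxE setU1K//.
  case: q aNtau => q1 q2 /= _.
  by rewrite (symbol_packet W (q1, q2) (exist _ (tau, i) pP)).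
(* The sending group is not that of [q]: its type lies in tau, the type of [q] does not. Hence the
   channel between them is invertible. *)
apply: contraNneq aNtau => <-; by rewrite gtype_member.
Qed.

(* The slot does not depend on [W] and [z]: in [gcmr_reliable] the noise depends
   on the sample point. *)
Lemma decode_gcmr (q : gnode Kg L) (p : packet n t) :
  gtype n_gt0 q.1 \notin (val p).1 ->
  exists s : slot n t Kg, forall W z,
  Defs.decode (gcmr t n_gt0 n_le h c) q W
    (received h (gcmr t n_gt0 n_le h c) W z q) p =
  demodulate c (fun u => modulate c (W q p) u + z (q, s, u)).
Proof.
case: p => [[tau i] pP]; set a := gtype n_gt0 q.1; set b := gbatch n q.1.
move=> /= aNtau; have /andP[/= /eqP card_tau i_tau] := pP.
have ai : a != i by apply: contraNneq aNtau => ->.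
have sP : (#|a |: tau| == t.+1) && (i \in a |: tau).
  by rewrite cardsU1 aNtau card_tau eqxx inE i_tau orbT.
pose s : slot n t Kg := exist _ (b, a |: tau, i) sP.
exists s => W z; rewrite /= /gcmr_decode /= -/a -/b.
have -> : insub (b, a |: tau, i) = Some s by exact: (valK s).
apply: (congr1 (demodulate c)); apply/funext => u.
rewrite received_gcmr /sender /=; last first.
  by apply: contraNneq aNtau => qE; rewrite /a qE gtype_member.
(* The term k' = a is the useful one; the others are exactly those that the decoder subtracts. *)
rewrite /gcmr_signal /= (bigD1 a) /=; last by rewrite !inE eqxx ai.
have /= rp := received_precoded W (q := q) (p := exist _ (tau, i) pP) u aNtau.
rewrite -/a -/b in rp.
rewrite mulmxDr mxE rp mulmx_sumr summxE addrAC.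
apply: (congr1 (fun x => x + _)); rewrite -[RHS]addr0 -addrA.
apply: (congr1 (fun x => _ + x)); apply/eqP; rewrite subr_eq0; apply/eqP.
by apply: eq_bigl => k'; rewrite !inE andbC.
Qed.

End GCMRCorrectness.

Lemma gcmr_reliable {R : realType} (n t Kg L : nat) (n_gt0 : (0 < n)%N)
    (n_le : (n <= Kg)%N) (h : gnode Kg L -> gnode Kg L -> R[i]) (l B : nat)
    (c : link_code R l B) (P eps : R) :
  (forall i i' : 'I_Kg, i != i' -> group_channel h i i' \in unitmx) ->
  0 <= eps -> link_reliable 1 P eps c ->
  reliable h (#|{: gnode Kg L * packet n t}|%:R * eps) (gcmr t n_gt0 n_le h c).
Proof.
move=> h_inv eps_ge0 [_ c_ok] d T Pr z zN A Out W m r.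
pose W' q j := m q (W j).
(* Vacuous for packets that the node has mapped, so that the union bound can run over all pairs. *)
pose good (qp : gnode Kg L * packet n t) (w : T) :=
  gtype n_gt0 qp.1.1 \notin (val qp.2).1 ->
  Defs.decode (gcmr t n_gt0 n_le h c) qp.1 W'
    (received h (gcmr t n_gt0 n_le h c) W' (csample z w) qp.1) qp.2 =
  W' qp.1 qp.2.
suff goodP qp : up_to Pr eps (good qp).
  have [E mE Egood] := up_to_forall goodP; exists E => // w /Egood good_w q.
  apply: (congr1 (r q)); apply/ffunP => p; rewrite !ffunE.
  have [//|] := boolP (_ \in _); rewrite inE => qp; exact: (good_w (q, p)).
case: qp => q p; have [aNp|ap] := boolP (gtype n_gt0 q.1 \notin (val p).1); last first.
  (* For a mapped packet the failure event is empty, of probability 0 <= eps. *)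
  by exists set0 => [|w _]; [rewrite measure0|rewrite /good /= (negPf ap)].
have [s decode_s] := decode_gcmr n_le c h_inv aNp.
pose f (u : 'I_l) := (q, s, u).
have f_inj : injective f by move=> u v [].
have [E mE Egood] := c_ok _ _ _ _ (awgn_comp f_inj zN) (W' q p).
exists E => // w /Egood Ew _; rewrite decode_s -[RHS]Ew.
by apply: (congr1 (demodulate c)); apply/funext => u; rewrite mul1r.
Qed.

(** * Transmit power *)

Lemma symbol_power {R : realType} (n t Kg L l B : nat) (c : link_code R l B) (P : R)
    (W : gnode Kg L -> packet n t -> B.-tuple bool) q tp :
  0 <= P -> (forall m, (\sum_u sqnorm (modulate c m u)) / l%:R <= P) ->
  (\sum_u sqnorm (symbol c W q tp u)) / l%:R <= P.
Proof.
move=> P_ge0 cP; rewrite /symbol; case: insubP => [p _ _|_]; first exact: cP.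
by rewrite big1 ?mul0r// => u _; exact: sqnorm0.
Qed.

(** [D] is chosen before the code and the power: it involves only the entries of the precoders,
    bounded by the sum [A] of all their squared moduli, and the numbers of terms. *)
Lemma gcmr_power {R : realType} (n t Kg L : nat) (n_gt0 : (0 < n)%N)
    (n_le : (n <= Kg)%N) (h : gnode Kg L -> gnode Kg L -> R[i]) :
  exists2 D : R, 0 <= D & forall l B (c : link_code R l B) (P : R),
    0 <= P -> (forall m, (\sum_u sqnorm (modulate c m u)) / l%:R <= P) ->
    forall W (s : slot n t Kg),
    (\sum_u \sum_(k in gcmr_active L n_le s)
        sqnorm (gcmr_encode n_le h c k W s u)) / l%:R <= D * P.
Proof.
have sum_le (I : finType) (F : I -> R) (x : R) :
    (forall i, F i <= x) -> \sum_i F i <= #|I|%:R * x.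
  by move=> Fx; rewrite mulr_natl -sumr_const; exact: ler_sum.
pose M i i' := invmx (group_channel h i i').
pose A : R := \sum_(x : 'I_Kg * 'I_Kg * 'I_L * 'I_L)
  sqnorm (M x.1.1.1 x.1.1.2 x.1.2 x.2).
have A_ge0 : 0 <= A by apply: sumr_ge0 => ? _; exact: sqnorm_ge0.
have MA i i' r j : sqnorm (M i i' r j) <= A.
  rewrite /A (bigD1 (i, i', r, j))//= lerDl sumr_ge0// => ? _.
  exact: sqnorm_ge0.
(* One factor of [sqnorm_sum] for the sum over k', one for the matrix product. *)
pose e : R := 2 ^+ size (index_enum 'I_n) * 2 ^+ size (index_enum 'I_L).
have e_ge0 : 0 <= e by rewrite mulr_ge0// exprn_ge0.
clearbody A.
have eA_ge0 : 0 <= e * A by rewrite mulr_ge0.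
exists (#|gnode Kg L|%:R * (e * A * (n * L)%:R)).
  by rewrite mulr_ge0// mulr_ge0.
move=> l B c P P_ge0 cP W s; case sE: (val s) => [[b Q] i].
have encode_le k u : sqnorm (gcmr_encode n_le h c k W s u) <=
    e * A * \sum_(k' : 'I_n) \sum_(j : 'I_L)
      sqnorm (symbol c W (member n_le b k', j) (Q :\ k', i) u).
  rewrite /gcmr_encode; case: ifP => _; last first.
    rewrite sqnorm0 mulr_ge0// sumr_ge0// => k' _.
    by rewrite sumr_ge0// => j _; exact: sqnorm_ge0.
  rewrite /gcmr_signal sE summxE (le_trans (sqnorm_sum _ _ _))//.
  rewrite /e -!mulrA ler_pM2l ?exprn_gt0// mulrA mulr_sumr.
  rewrite [leRHS](bigID (fun k' => k' \in Q :\ i)) /= ler_wpDr//.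
    rewrite sumr_ge0// => k' _; rewrite !mulr_ge0 ?exprn_ge0// sumr_ge0// => j _.
    exact: sqnorm_ge0.
  apply: ler_sum => k' _; rewrite mxE (le_trans (sqnorm_sum _ _ _))//.
  rewrite -mulrA ler_pM2l ?exprn_gt0// mulr_sumr; apply: ler_sum => j _.
  by rewrite sqnormM mxE ler_wpM2r ?sqnorm_ge0// MA.
clearbody e.
(* Once the sums are exchanged, each of the at most n L inner terms is the average power of a single
   symbol. *)
have total_le k : (\sum_u sqnorm (gcmr_encode n_le h c k W s u)) / l%:R <=
    e * A * (n * L)%:R * P.
  apply: le_trans (_ : (\sum_u e * A * \sum_(k' : 'I_n) \sum_(j : 'I_L)
      sqnorm (symbol c W (member n_le b k', j) (Q :\ k', i) u)) / l%:R <= _).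
    by rewrite ler_wpM2r ?invr_ge0// ler_sum.
  rewrite -mulr_sumr -[leLHS]mulrA -[leRHS]mulrA; apply: ler_wpM2l => //.
  rewrite exchange_big mulr_suml /=.
  rewrite natrM -mulrA -[n in leRHS]card_ord; apply: (sum_le) => k'.
  rewrite exchange_big mulr_suml /= -[L in leRHS]card_ord; apply: sum_le => j.
  exact: symbol_power.
rewrite exchange_big mulr_suml /=.
rewrite -mulrA mulr_natl -sumr_const [leRHS](bigID (mem (gcmr_active L n_le s))) /=.
rewrite ler_wpDr ?ler_sum// sumr_ge0// => k _.
by rewrite !mulr_ge0.
Qed.

(** * Assembly: batches, unit-gain links, high SNR and delay *)

Lemma batches_dvdn n Kg : (0 < Kg)%N -> (n %| Kg)%N -> (batches n Kg * n)%N = Kg.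
Proof.
move=> Kg_gt0 /dvdnP[q KgE]; rewrite {}KgE in Kg_gt0 *; rewrite /batches.
case: q n Kg_gt0 => [//|q] [|n] // _; first by rewrite !muln0.
have -> : (q.+1 * n.+1).-1 = (q * n.+1 + n)%N by rewrite mulSn addSn addnC.
by rewrite divnMDl// divn_small// addn0.
Qed.

(** Zero-forcing yields unit-gain links, while the given code is meant for gain [g]: the gain is
    moved into the transmitter. *)
Definition scale_code {R : realType} (g : R[i]) l B (c : link_code R l B) :
    link_code R l B :=
  LinkCode (fun m u => g * modulate c m u) (demodulate c).

Lemma power_scale_code {R : realType} (g : R[i]) l B (c : link_code R l B) (P : R) :
  (forall m, (\sum_u sqnorm (modulate c m u)) / l%:R <= P) ->
  forall m, (\sum_u sqnorm (modulate (scale_code g c) m u)) / l%:R <= sqnorm g * P.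
Proof.
move=> cP m; under eq_bigr do rewrite /= sqnormM.
by rewrite -mulr_sumr -mulrA ler_wpM2l ?sqnorm_ge0.
Qed.

(* Absolute value: [link_reliable] alone does not force [eps] to be nonnegative,
   since it is vacuous if no noise exists. *)
Lemma link_reliable_scale {R : realType} (g : R[i]) l B (c : link_code R l B)
    (P eps : R) :
  g != 0 -> link_reliable g P eps c ->
  link_reliable 1 (sqnorm g * P) `|eps| (scale_code g c).
Proof.
move=> g_neq0 [cP c_ok]; split=> [m|d T Pr z zN m].
  under eq_bigr do rewrite /= sqnormM.
  rewrite -mulr_sumr -mulrA ltr_pM2l// lt_def sqnorm_ge0 andbT.
  apply: contraNneq g_neq0; case: g {c_ok} => a b; rewrite /sqnorm /= => /eqP.
  by rewrite paddr_eq0 ?sqr_ge0// !sqrf_eq0 eq_complex /=.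
have [E [mE PE] Egood] := c_ok _ _ _ _ zN m.
exists E => [|w /Egood Ew].
  by split => //; apply: le_trans PE _; rewrite lee_fin ler_norm.
rewrite -[RHS]Ew /=; apply: (congr1 (demodulate c)); apply/funext => u.
by rewrite mul1r.
Qed.

Lemma gcmr_high_snr_link {R : realType} (n t Kg L : nat) (n_gt0 : (0 < n)%N)
    (n_le : (n <= Kg)%N) (h : gnode Kg L -> gnode Kg L -> R[i]) (g : R[i])
    (beta : R) (l : nat) :
  (forall i i' : 'I_Kg, i != i' -> group_channel h i i' \in unitmx) ->
  g != 0 -> link_high_snr g beta l -> gcmr_high_snr t n_gt0 n_le h beta l.
Proof.
move=> h_inv g_neq0 [B [c [eps [BP eps0 c_ok]]]].
have [D D_ge0 DP] := gcmr_power t n_gt0 n_le h.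
(* [D] accounts for precoding, [sqnorm g] for the rescaled code; the summand 1 makes [C] positive
   and the power bound strict. *)
pose C := D * sqnorm g + 1.
have C_gt0 : 0 < C by rewrite ltr_wpDl// mulr_ge0// sqnorm_ge0.
have divCy : (P / C @[P --> +oo] --> +oo)%classic by exact: cvg_divy.
pose N : R := #|{: gnode Kg L * packet n t}|%:R.
exists (fun P => B (P / C)), (fun P => scale_code g (c (P / C))),
  (fun P => N * `|eps (P / C)|); split.
- exact: message_size_scale.
- suff : (N * `|eps (P / C)| @[P --> +oo] --> N * `|0 : R|)%classic.
    by rewrite normr0 mulr0.
  apply: cvgM; first exact: cvg_cst.
  by apply: cvg_norm; exact: cvg_comp divCy eps0.
- near=> P.
  have P_gt0 : 0 < P by near: P; exact: nbhs_pinfty_gt.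
  have cP_ok : link_reliable g (P / C) (eps (P / C)) (c (P / C)).
    by near: P; exact: divCy c_ok.
  split.
  + exact: gcmr_local.
  + exact: card_gcmr_active.
  + move=> W s; apply: le_lt_trans (DP _ _ _ (sqnorm g * (P / C)) _ _ W s) _.
    * by rewrite mulr_ge0 ?sqnorm_ge0// divr_ge0// ltW.
    * by apply: power_scale_code => m; apply: ltW; case: cP_ok.
    * have -> : D * (sqnorm g * (P / C)) = P * (D * sqnorm g / C) by ring.
      by rewrite gtr_pMr// ltr_pdivrMr// mul1r ltrDl.
  + exact: gcmr_reliable h_inv (normr_ge0 _) (link_reliable_scale g_neq0 cP_ok).
Unshelve. all: by end_near. Qed.

Theorem theorem1 (R : realType) (K L Smax : nat) (gamma : R)
  (h : gnode (K %/ L) L -> gnode (K %/ L) L -> R[i])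
  (g : R[i]) (beta : R) (l : nat)
  (L_gt0 : (0 < L)%N) (L_dvd : (L %| K)%N)
  (gammaE : exists2 t0 : nat, (0 < t0 <= K %/ L)%N
                            & gamma = t0%:R / (K %/ L)%:R)
  (feasible : exists2 Kt : nat, (Kt <= K)%N & admissible gamma L Smax Kt)
  (h_inv : forall i i' : 'I_(K %/ L), i != i' ->
             group_channel h i i' \in unitmx)
  (g_neq0 : g != 0)
  (link : link_high_snr g beta l) :
  let KL := Kbar gamma L Smax K in
  let n := (KL %/ L)%N in
  let t := redundancy gamma L KL in
  let n_gt0 := Kbar_group_gt0 L_gt0 feasible in
  let n_le := Kbar_group_le gamma L Smax K in
  let S := #|packet n t| in
  let T := (Tc K S l)%:R : R in
  [/\ (S <= Smax)%N,
      forall k : gnode (K %/ L) L,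
        #|gcmr_assigned t n_gt0 k|%:R = gamma * S%:R,
      gcmr_high_snr t n_gt0 n_le h beta l
    & forall (B : nat) (c : link_code R l B),
        let T_GCMR := (delay (gcmr t n_gt0 n_le h c))%:R : R in
        ((KL %| K)%N -> T_GCMR = (1 - gamma) / tbar gamma L Smax K * T) /\
        T_GCMR = (batches n (K %/ L) * KL)%:R / K%:R *
                 ((1 - gamma) / tbar gamma L Smax K * T)].
Proof.
move=> KL n t n_gt0 n_le S T.
have aKL : admissible gamma L Smax KL := Kbar_admissible feasible.
have [t_gt0 tE] := admissible_redundancy L_gt0 aKL.
have KLE : KL = (n * L)%N by rewrite divnK//; case/and3P: aKL.
have n_neq0 : n%:R != 0 :> R by rewrite pnatr_eq0 -lt0n.
have L_neq0 : L%:R != 0 :> R by rewrite pnatr_eq0 -lt0n.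
have K_gt0 : (0 < K)%N by rewrite lt0n; apply: contraTneq n_gt0 => K0;
  rewrite -leqNgt (leq_trans n_le)// K0 div0n.
have K_neq0 : K%:R != 0 :> R by rewrite pnatr_eq0 -lt0n.
have t_neq0 : t%:R != 0 :> R by rewrite pnatr_eq0 -lt0n.
have SE : S = (t * 'C(n, t))%N by exact: card_packet.
have gammaE' : gamma = t%:R / n%:R by rewrite tE mulfK.
have delayE B (c : link_code R l B) :
    (delay (gcmr t n_gt0 n_le h c))%:R = (batches n (K %/ L) * KL)%:R / K%:R *
                 ((1 - gamma) / tbar gamma L Smax K * T).
  rewrite /delay card_slot mul_bin_left -/n -/t /T /Tc -/S SE /tbar -/KL KLE gammaE'.
  (* The truncated subtraction n - t is the real one when t <= n; otherwise C(n, t) = 0 and both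
     sides vanish. *)
  have t_le : (t <= n)%N \/ 'C(n, t) = 0.
    by have [|/bin_small ->] := leqP t n; [left|right].
  rewrite !natrM; case: t_le => [t_le|->]; last by rewrite !(mulr0, mul0r).
  by rewrite natrB//; field; rewrite t_neq0 K_neq0 n_neq0 L_neq0.
split.
- by rewrite SE; case/and5P: aKL.
- move=> k; rewrite card_gcmr_assigned// -/n SE [X in X * _]gammaE'.
  (* Since n C(n-1, t-1) = t C(n, t), the assigned packets are a fraction t / n of all. *)
  have := mul_bin_diag n t.-1; rewrite prednK// => <-.
  by rewrite !natrM mulrA mulfVK.
- exact: gcmr_high_snr_link link.
- move=> B c T_GCMR; split=> [KL_dvd|]; last exact: delayE.
  (* If [KL] divides [K], then n divides K / L, no batch is completed artificially, and the
     prefactor is 1. *)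
  rewrite /T_GCMR delayE KLE mulnA batches_dvdn ?divnK// ?divff ?mul1r//.
    by rewrite divn_gt0// dvdn_leq.
  by rewrite dvdn_divRL// -KLE.
Qed.
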